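(* Consider the Lyapunov equation $$A X E^{\mathsf H} + E X A^{\mathsf H} + B R B^{\mathsf H} = 0$$ with $A, E \in \mathbb{C}^{n\times n}$, $B \in \mathbb{C}^{n\times m}$ and $R\in\mathbb{C}^{m\times m}$ Hermitian, where $E$ is invertible and all eigenvalues of the matrix pencil $\lambda E - A$ lie in the open left half-plane $\mathbb{C}_-$, and assume that $R$ is invertible. Let $X_{j-1} = L_{j-1} D_{j-1} L_{j-1}^{\mathsf H}$ be the ADI iterate at step $j-1$, with the associated Lyapunov residual $\mathcal{L}_{j-1} = W_{j-1} R W_{j-1}^{\mathsf H}$. Given the next ADI shift $\alpha_j \in \mathbb{C}_-$ and the tangential direction $t_j\in\mathbb{C}^m$, the rank-$1$ compressed ADI update of the form $$X_j = X_{j-1} + d_j v_j v_j^{\mathsf H}$$ is given via the scalar $$d_j = \frac{-2\operatorname{Re}(\alpha_j)}{t_j^{\mathsf H} R^{-1} t_j}$$ and $v_j\in\mathbb{C}^n$ as the solution to the linear system $$(A + \alpha_j E) v_j = W_{j-1} t_j.$$ The corresponding Lyapunov residual has the form $\mathcal{L}_j = W_j R W_j^{\mathsf H}$, where $$W_j = W_{j-1} - \frac{2\operatorname{Re}(\alpha_j)\, E v_j t_j^{\mathsf H} R^{-1}}{t_j^{\mathsf H} R^{-1} t_j}.$$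
   Context: $M^{\mathsf H}$ denotes the conjugate transpose of $M$, and $\mathbb{C}_-=\{z\in\mathbb{C}:\operatorname{Re} z<0\}$. The Lyapunov residual of an iterate $X_j$ is $\mathcal{L}_j = A X_j E^{\mathsf H} + E X_j A^{\mathsf H} + B R B^{\mathsf H}$. The low-rank ADI (alternating direction implicit) iteration generates approximations $X_j = L_j D_j L_j^{\mathsf H}$ of the solution of the Lyapunov equation, starting from $X_0=0$ and residual factor $W_0=B$, using shifts $\alpha_j\in\mathbb{C}_-$. In its classical block form, one step solves $(A+\alpha_jE)V_j=W_{j-1}$ for $V_j\in\mathbb{C}^{n\times m}$ and sets $X_j=X_{j-1}-2\operatorname{Re}(\alpha_j)V_jRV_j^{\mathsf H}$ and $W_j=W_{j-1}-2\operatorname{Re}(\alpha_j)EV_j$; the residual is then $\mathcal{L}_j=W_jRW_j^{\mathsf H}$ with $W_j\in\mathbb{C}^{n\times m}$. In the tangential form, the block $V_j$ with $m$ columns is replaced by a single vector $v_j$ obtained by compressing along a tangential direction $t_j\in\mathbb{C}^m$, and the step is the one described in the claim. The matrix $R$ may be indefinite. *)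

(* Defs.v *)
From mathcomp Require Export all_boot all_order all_algebra.
From mathcomp Require Export sesquilinear spectral.
From mathcomp Require Export reals complex.

Set Implicit Arguments.
Unset Strict Implicit.
Unset Printing Implicit Defensive.

Import Order.TTheory GRing.Theory Num.Theory.

Local Open Scope ring_scope.
Local Open Scope sesquilinear_scope.

(* M ^t* is the conjugate transpose, and R \is hermsymmx says R = R ^t*.
   'Re z is an element of C, real for the partial order of C. *)

Definition pencil_eigenvalue (C : numClosedFieldType) (n : nat)
    (A E : 'M[C]_n) (lambda : C) : Prop :=
  \det (lambda *: E - A) = 0.

Definition lyapunov_residual (C : numClosedFieldType) (n m : nat)
    (A E : 'M[C]_n) (B : 'M[C]_(n, m)) (R : 'M[C]_m) (X : 'M[C]_n) : 'M[C]_n :=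
  A *m X *m E ^t* + E *m X *m A ^t* + B *m R *m B ^t*.

(* The scalar t^H R^-1 t, read off from a 1 x 1 matrix. *)
Definition tangential_weight (C : numClosedFieldType) (m : nat)
    (R : 'M[C]_m) (t : 'cV[C]_m) : C :=
  (t ^t* *m invmx R *m t) 0 0.

Definition tangential_coef (C : numClosedFieldType) (m : nat)
    (R : 'M[C]_m) (alpha : C) (t : 'cV[C]_m) : C :=
  - 2 * 'Re alpha / tangential_weight R t.

Definition tangential_iterate (C : numClosedFieldType) (n m : nat)
    (R : 'M[C]_m) (alpha : C) (t : 'cV[C]_m) (v : 'cV[C]_n)
    (X : 'M[C]_n) : 'M[C]_n :=
  X + tangential_coef R alpha t *: (v *m v ^t*).

Definition tangential_factor (C : numClosedFieldType) (n m : nat)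
    (E : 'M[C]_n) (R : 'M[C]_m) (alpha : C) (t : 'cV[C]_m) (v : 'cV[C]_n)
    (W : 'M[C]_(n, m)) : 'M[C]_(n, m) :=
  W - (2 * 'Re alpha / tangential_weight R t) *: (E *m v *m t ^t* *m invmx R).

(* adi_iterate A E B R j X W: after j steps the iteration can be at the iterate
   X with residual factor W, for some choice of shifts and, at each step, of
   either the block form or the tangential form along some direction. The
   tangential form is only available when its denominator is nonzero, which
   is not automatic because R may be indefinite. *)
Inductive adi_iterate (C : numClosedFieldType) (n m : nat)
    (A E : 'M[C]_n) (B : 'M[C]_(n, m)) (R : 'M[C]_m) :
    nat -> 'M[C]_n -> 'M[C]_(n, m) -> Prop :=
| adi_start : adi_iterate A E B R 0 0 B
| adi_block_step (j : nat) (X : 'M[C]_n) (W : 'M[C]_(n, m))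
    (alpha : C) (V : 'M[C]_(n, m)) :
    adi_iterate A E B R j X W ->
    'Re alpha < 0 ->
    (A + alpha *: E) *m V = W ->
    adi_iterate A E B R j.+1
      (X - (2 * 'Re alpha) *: (V *m R *m V ^t*))
      (W - (2 * 'Re alpha) *: (E *m V))
| adi_tangential_step (j : nat) (X : 'M[C]_n) (W : 'M[C]_(n, m))
    (alpha : C) (t : 'cV[C]_m) (v : 'cV[C]_n) :
    adi_iterate A E B R j X W ->
    'Re alpha < 0 ->
    tangential_weight R t != 0 ->
    (A + alpha *: E) *m v = W *m t ->
    adi_iterate A E B R j.+1
      (tangential_iterate R alpha t v X)
      (tangential_factor E R alpha t v W).

(* Main.v *)
(** A block step preserves the form W R W^H of the residual as soon as its
    solve (A + alpha E) Y = W holds after multiplication by R Y^H on the right.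
    A tangential step is such a relaxed block step, with the rank-one block
    Y = v t^H R^-1 / (t^H R^-1 t). *)
Require Import Defs.
From mathcomp Require Import ring.
Import Order.TTheory GRing.Theory Num.Theory.
Local Open Scope ring_scope.
Local Open Scope sesquilinear_scope.

Set Implicit Arguments.
Unset Strict Implicit.
Unset Printing Implicit Defensive.

Section ConjugateTranspose.
Variable C : numClosedFieldType.

Lemma ctmx_mul (m n p : nat) (M : 'M[C]_(m, n)) (N : 'M[C]_(n, p)) :
  (M *m N) ^t* = N ^t* *m M ^t*.
Proof. by rewrite trmx_mul map_mxM. Qed.

Lemma ctmxB (m n : nat) (M N : 'M[C]_(m, n)) : (M - N) ^t* = M ^t* - N ^t*.
Proof. by rewrite linearB map_mxB. Qed.

Lemma ctmxZ (m n : nat) (a : C) (M : 'M[C]_(m, n)) :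
  (a *: M) ^t* = a^* *: M ^t*.
Proof. by rewrite linearZ map_mxZ. Qed.

Lemma ctmx_inv (n : nat) (M : 'M[C]_n) : (invmx M) ^t* = invmx (M ^t*).
Proof. by rewrite trmx_inv map_invmx. Qed.

Lemma hermsymmx_ct (n : nat) (M : 'M[C]_n) : M \is hermsymmx -> M ^t* = M.
Proof. by move/is_hermitianmxP=> {2}->; rewrite expr0 scale1r. Qed.

Lemma double_Re (z : C) : 2 * 'Re z = z + z^*.
Proof. by rewrite ReE mulrC divfK ?pnatr_eq0. Qed.

End ConjugateTranspose.

(** If [A + alpha E] were singular, [- alpha] would be a pencil eigenvalue, and its real part is
    positive. *)
Lemma stable_shift_unitmx (C : numClosedFieldType) (n : nat)
    (A E : 'M[C]_n) (alpha : C) :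
  (forall lambda : C, pencil_eigenvalue A E lambda -> 'Re lambda < 0) ->
  'Re alpha < 0 -> A + alpha *: E \in unitmx.
Proof.
move=> stable alpha_neg; rewrite unitmxE unitfE; apply/negP=> /eqP det0.
have : 'Re (- alpha) < 0.
  apply: stable; rewrite /pencil_eigenvalue.
  by rewrite scaleNr -opprD addrC -scaleN1r detZ det0 mulr0.
by rewrite raddfN oppr_lt0 => /(lt_trans alpha_neg); rewrite ltxx.
Qed.

Section Residual.
Variables (C : numClosedFieldType) (n m : nat).
Variables (A E : 'M[C]_n) (B : 'M[C]_(n, m)) (R : 'M[C]_m).
Hypothesis R_herm : R \is hermsymmx.

(** With [S = Y R Y^H] and [c = 2 Re alpha], the solve turns [A S E^H + E S A^H] into
    [W R Y^H E^H + E Y R W^H - c E S E^H]. Times [-c], these are the cross terms and the quadratic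
    term of the right-hand side. *)
Lemma residual_step (X : 'M[C]_n) (W Y : 'M[C]_(n, m)) (alpha : C) :
  (A + alpha *: E) *m Y *m R *m Y ^t* = W *m R *m Y ^t* ->
  lyapunov_residual A E B R X = W *m R *m W ^t* ->
  lyapunov_residual A E B R (X - (2 * 'Re alpha) *: (Y *m R *m Y ^t*)) =
  (W - (2 * 'Re alpha) *: (E *m Y)) *m R *m
    (W - (2 * 'Re alpha) *: (E *m Y)) ^t*.
Proof.
move=> solveY resX; have Rt := hermsymmx_ct R_herm.
have c_real : (2 * 'Re alpha)^* = 2 * 'Re alpha.
  by rewrite conj_Creal // rpredM ?realn ?Creal_Re.
have cE := double_Re alpha.
set c := 2 * 'Re alpha in c_real cE *.
set S := Y *m R *m Y ^t*.
have AS : A *m S = W *m R *m Y ^t* - alpha *: (E *m S).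
  by rewrite -solveY !mulmxDl -!scalemxAl !mulmxA addrK.
have SA : S *m A ^t* = Y *m R *m W ^t* - alpha^* *: (S *m E ^t*).
  (* Conjugate transpose of [AS], where [S] is Hermitian because [R] is. *)
  have := congr1 (fun M : 'M_n => M ^t*) AS.
  by rewrite ctmxB ctmxZ !ctmx_mul !trmxCK Rt !mulmxA.
have -> : lyapunov_residual A E B R (X - c *: S) =
    lyapunov_residual A E B R X -
    c *: (A *m S *m E ^t* + E *m (S *m A ^t*)).
  rewrite /lyapunov_residual !(mulmxBr, mulmxBl) -!(scalemxAl, scalemxAr).
  by rewrite mulmxA scalerDr addrACA -opprD [RHS]addrAC.
rewrite resX AS SA !(mulmxBr, mulmxBl, ctmxB, ctmxZ, ctmx_mul) c_real.
rewrite -!(scalemxAl, scalemxAr) /S !mulmxA.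
(* Writing [c] as [alpha] plus its conjugate matches the two shift terms with the [c^2] term. *)
by apply/matrixP=> i j; rewrite !mxE cE; ring.
Qed.

Section Tangential.
Hypothesis R_inv : R \in unitmx.
Variables (t : 'cV[C]_m) (v : 'cV[C]_n).
Hypothesis t_adm : tangential_weight R t != 0.

Definition tangential_block : 'M[C]_(n, m) :=
  (tangential_weight R t)^-1 *: (v *m t ^t* *m invmx R).

(** The inverse of [R] is again Hermitian, so its quadratic form takes real values. Hence the weight
    passes unchanged through the conjugation in [Y^H]. *)
Lemma tangential_weight_real : tangential_weight R t \is Num.real.
Proof.
apply/CrealP.
have -> : (tangential_weight R t)^* = (t ^t* *m invmx R *m t) ^t* 0 0.
  by rewrite [RHS]mxE [X in _ = X^*]mxE.
by rewrite !ctmx_mul ctmx_inv trmxCK (hermsymmx_ct R_herm) mulmxA.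
Qed.

Lemma tangential_blockR :
  R *m tangential_block ^t* = (tangential_weight R t)^-1 *: (t *m v ^t*).
Proof.
rewrite ctmxZ conj_Creal ?rpredV ?tangential_weight_real //.
rewrite !ctmx_mul ctmx_inv trmxCK.
by rewrite (hermsymmx_ct R_herm) -scalemxAr mulKVmx.
Qed.

Lemma tangential_block_gram :
  tangential_block *m R *m tangential_block ^t* =
  (tangential_weight R t)^-1 *: (v *m v ^t*).
Proof.
rewrite -mulmxA tangential_blockR -scalemxAr -scalemxAl.
rewrite -[v *m _ *m _]mulmxA -[v *m _ *m _]mulmxA [_ *m (t *m _)]mulmxA.
(* The inner 1 x 1 product [t^H R^-1 t] is the weight itself and cancels one of the two inverse
   weights. *)
rewrite [_ *m t]mx11_scalar mul_scalar_mx -scalemxAr.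
by rewrite [X in _ *: X]scalerA mulVf // scale1r.
Qed.

Lemma tangential_iterateE (alpha : C) (X : 'M[C]_n) :
  tangential_iterate R alpha t v X =
  X - (2 * 'Re alpha) *: (tangential_block *m R *m tangential_block ^t*).
Proof.
rewrite tangential_block_gram scalerA -scaleNr.
by rewrite /tangential_iterate /tangential_coef !mulNr.
Qed.

Lemma tangential_factorE (alpha : C) (W : 'M[C]_(n, m)) :
  tangential_factor E R alpha t v W =
  W - (2 * 'Re alpha) *: (E *m tangential_block).
Proof. by rewrite -scalemxAr scalerA !mulmxA. Qed.

(** For the rank-one block [Y], [(A + alpha E) Y = W P] with the oblique projector
    [P = t t^H R^-1 / (t^H R^-1 t)] onto the span of [t]. The columns of [R Y^H] are multiples of
    [t], so [P] fixes them and the relaxed solve holds. *)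
Lemma tangential_residual (X : 'M[C]_n) (W : 'M[C]_(n, m)) (alpha : C) :
  (A + alpha *: E) *m v = W *m t ->
  lyapunov_residual A E B R X = W *m R *m W ^t* ->
  lyapunov_residual A E B R (tangential_iterate R alpha t v X) =
  tangential_factor E R alpha t v W *m R *m
    (tangential_factor E R alpha t v W) ^t*.
Proof.
move=> solve_v resX; rewrite tangential_iterateE tangential_factorE.
apply: residual_step => //.
(* Up to the inverse weight, the two sides are [(A + alpha E) v v^H] and [W t v^H]. *)
rewrite -mulmxA -mulmxA [tangential_block *m _]mulmxA tangential_block_gram.
rewrite -[W *m R *m _]mulmxA tangential_blockR -!scalemxAr !mulmxA.
by rewrite solve_v.
Qed.

End Tangential.

(** Induction on the iteration: [X = 0] leaves only [B R B^H], and either kind of step preserves the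
    factored form. *)
Lemma adi_residual (j : nat) (X : 'M[C]_n) (W : 'M[C]_(n, m)) :
  R \in unitmx -> adi_iterate A E B R j X W ->
  lyapunov_residual A E B R X = W *m R *m W ^t*.
Proof.
move=> R_inv; elim=> {j X W} [|j X W alpha V _ IH _ solveV|
  j X W alpha t v _ IH _ t_adm solve_v].
- by rewrite /lyapunov_residual !(mulmx0, mul0mx) !add0r.
- by apply: residual_step; rewrite // solveV.
- exact: tangential_residual.
Qed.

End Residual.

Theorem theorem1 (K : realType) (n m : nat)
    (A E : 'M[K[i]]_n) (B : 'M[K[i]]_(n, m)) (R : 'M[K[i]]_m)
    (R_herm : R \is hermsymmx)
    (E_inv : E \in unitmx)
    (pencil_stable : forall lambda : K[i],
       pencil_eigenvalue A E lambda -> 'Re lambda < 0)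
    (R_inv : R \in unitmx)
    (j : nat) (j_gt0 : (0 < j)%N)
    (X : 'M[K[i]]_n) (W : 'M[K[i]]_(n, m))
    (XW_adi : adi_iterate A E B R j.-1 X W)
    (k : nat) (L : 'M[K[i]]_(n, k)) (D : 'M[K[i]]_k)
    (X_LDL : X = L *m D *m L ^t*)
    (alpha : K[i]) (alpha_neg : 'Re alpha < 0)
    (t : 'cV[K[i]]_m) (t_adm : tangential_weight R t != 0) :
  lyapunov_residual A E B R X = W *m R *m W ^t* /\
  exists v : 'cV[K[i]]_n,
    [/\ (A + alpha *: E) *m v = W *m t,
        forall u : 'cV[K[i]]_n, (A + alpha *: E) *m u = W *m t -> u = v,
        adi_iterate A E B R j
          (tangential_iterate R alpha t v X)
          (tangential_factor E R alpha t v W) &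
        lyapunov_residual A E B R (tangential_iterate R alpha t v X) =
          tangential_factor E R alpha t v W *m R *m
            (tangential_factor E R alpha t v W) ^t* ].
Proof.
have resX := adi_residual R_herm R_inv XW_adi.
have shift_inv := stable_shift_unitmx pencil_stable alpha_neg.
split=> //; exists (invmx (A + alpha *: E) *m (W *m t)).
have solve_v := mulKVmx shift_inv (W *m t).
split=> //.
- by move=> u <-; rewrite mulKmx.
(* The constructor ends at [j.-1.+1], which is [j] because [j] is positive. *)
- by rewrite -(prednK j_gt0); apply: adi_tangential_step.
- exact: tangential_residual.
Qed.
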